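(* Let $\Bbbk$ be a field of characteristic zero and $U$ a finite-dimensional $\Bbbk$-vector space. For every $r\ge0$, the map $$\frac{D_{r+1}\otimes U^*}{\delta(D_{r+2})}\xrightarrow{\ \sim\ }\mathcal Z^2(U)_r,\qquad[\alpha]\longmapsto\delta\alpha,$$ is an isomorphism. If $\dim U=3$, the canonical map $U\otimes\Lambda^3U^*\simeq\Lambda^2U^*$ (contraction) identifies $\mathcal Z^2(U)$ with $$\ker\Bigl(\operatorname{div}:D\otimes U\otimes\Lambda^3U^*\longrightarrow D\otimes\Lambda^3U^*\Bigr),\qquad\operatorname{div}(f\otimes u\otimes\omega)=(u\circ f)\otimes\omega.$$ Thus rank-three inverse systems are determinant-twisted divergence-free polynomial vector fields, with $R=\operatorname{Sym}(U)$ acting by constant-coefficient differentiation (contraction on the factor $D$).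
   Context: $R=\operatorname{Sym}(U)$; $D=\bigoplus_{r\ge0}R_r^*$ is its restricted graded (divided-power) dual, $D_r=R_r^*$, with contraction action $\langle p',p\circ f\rangle=\langle pp',f\rangle$; so $u\in U$ maps $D_{r}$ to $D_{r-1}$. The Koszul differential $\delta:D_r\otimes\Lambda^qU^*\to D_{r-1}\otimes\Lambda^{q+1}U^*$ is $(\delta\alpha)(u_0,\dots,u_q)=\sum_i(-1)^iu_i\circ\alpha(u_0,\dots,\widehat{u_i},\dots,u_q)$; in particular for $q=2$, $(\delta\Phi)(u,v,w)=u\circ\Phi(v,w)-v\circ\Phi(u,w)+w\circ\Phi(u,v)$. $\mathcal Z^2(U)=\ker(\delta:D\otimes\Lambda^2U^*\to D\otimes\Lambda^3U^* )$ is the module of closed divided-power 2-forms, with $\mathcal Z^2(U)_r\subset D_r\otimes\Lambda^2U^*$; it is the restricted graded dual of the derived module $B(U)$ of the free metabelian Lie algebra on $U$, and finite-dimensional graded $R$-submodules of it are called inverse systems. *)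

(* Defs.v *)
From HB Require Import structures.
From mathcomp Require Import all_boot all_algebra perm.
From mathcomp Require Import boolp classical_sets functions.
From mathcomp Require Import generic_quotient ring_quotient mpoly.

Set Implicit Arguments.
Unset Strict Implicit.
Unset Printing Implicit Defensive.

Import GRing.Theory.
Local Open Scope ring_scope.

(* Subspaces as types, and quotients by subspaces, for vector spaces that are
   not assumed to be finite-dimensional. *)
Section Submodules.
Variables (K : fieldType) (V : lmodType K) (S : submodClosed V).

Record subm := Subm { subm_val : V; _ : subm_val \in S }.
HB.instance Definition _ := [isSub for subm_val].
HB.instance Definition _ := [Choice of subm by <:].
HB.instance Definition _ := [SubChoice_isSubLmodule of subm by <:].

(* The library's submodClosed structure does not include closure under
   opposites, which {ideal_quot _} requires. *)
Definition submod_pred : {pred V} := S.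

Fact submod_pred_zmod_closed : zmod_closed submod_pred.
Proof.
split=> [|x y xS yS]; first exact: (rpred0 S).
by rewrite -scaleN1r -[_ \in _]/(x + -1 *: y \in S) rpredD ?rpredZ.
Qed.
HB.instance Definition _ :=
  GRing.isZmodClosed.Build V submod_pred submod_pred_zmod_closed.

Definition quotm := {ideal_quot submod_pred}.
HB.instance Definition _ := GRing.Zmodule.on quotm.

Definition quotm_pi (x : V) : quotm := (\pi_{ideal_quot submod_pred} x)%qT.
Definition quotm_scale (a : K) (x : {ideal_quot submod_pred}) : quotm := quotm_pi (a *: repr x).

Lemma quotm_piE x y : (quotm_pi x = quotm_pi y) <-> (x - y \in S).
Proof.
by rewrite -[_ \in S]/(_ \in submod_pred) Quotient.idealrBE; split => [/eqP//|/eqP].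
Qed.

Lemma quotm_repr (x : {ideal_quot submod_pred}) : quotm_pi (repr x) = x.
Proof. exact: reprK. Qed.

Lemma quotm_pi_surj (x : {ideal_quot submod_pred}) : exists v, x = quotm_pi v.
Proof. by exists (repr x); rewrite quotm_repr. Qed.

Lemma quotm_scaleE a x : quotm_scale a (quotm_pi x) = quotm_pi (a *: x).
Proof.
apply/quotm_piE; rewrite -scalerBr rpredZ //.
by apply/quotm_piE; rewrite quotm_repr.
Qed.

Lemma quotm_piD x y : quotm_pi (x + y) = quotm_pi x + quotm_pi y.
Proof. exact: raddfD. Qed.

Fact quotm_scaleA a b x :
  quotm_scale a (quotm_scale b x) = quotm_scale (a * b) x.
Proof.
by have [v ->] := quotm_pi_surj x; rewrite !quotm_scaleE scalerA.
Qed.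

Fact quotm_scale1 : left_id 1 quotm_scale.
Proof. by move=> x; have [v ->] := quotm_pi_surj x; rewrite quotm_scaleE scale1r. Qed.

Fact quotm_scaleDr : right_distributive quotm_scale +%R.
Proof.
move=> a x y; have [v ->] := quotm_pi_surj x; have [w ->] := quotm_pi_surj y.
by rewrite -quotm_piD !quotm_scaleE scalerDr quotm_piD.
Qed.

Fact quotm_scaleDl x : {morph quotm_scale^~ x : a b / a + b}.
Proof.
move=> a b; have [v ->] := quotm_pi_surj x.
by rewrite !quotm_scaleE scalerDl quotm_piD.
Qed.

HB.instance Definition _ := GRing.Zmodule_isLmodule.Build K quotm
  quotm_scaleA quotm_scale1 quotm_scaleDr quotm_scaleDl.

Fact quotm_pi_linear : linear quotm_pi.
Proof. by move=> a x y; rewrite quotm_piD -quotm_scaleE. Qed.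
HB.instance Definition _ := GRing.isLinear.Build K V quotm _ quotm_pi
  quotm_pi_linear.

End Submodules.

(* The symmetric algebra of U, in coordinates: the polynomial ring whose
   variables are the members of the basis [vbasis fullv] of U, with the
   embedding [symU] of U; universality is [symU_universal]. *)
Notation SymAlg K U := {mpoly K[\dim (fullv : {vspace U})]} (only parsing).

Section SymmetricAlgebra.
Variables (K : fieldType) (U : vectType K).

Definition bas (i : 'I_(\dim {:U})) : U := (vbasis {:U})`_i.
Definition crd (i : 'I_(\dim {:U})) (u : U) : K := coord (vbasis {:U}) i u.

Definition symU (u : U) : SymAlg K U := \sum_i crd i u *: 'X_i.

Fact crd_is_scalar i : scalar (crd i).
Proof. by move=> a u v; rewrite /crd linearP. Qed.

Lemma crd_sum u : u = \sum_i crd i u *: bas i.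
Proof. exact: coord_vbasis (memvf u). Qed.

Lemma crd_bas i j : crd i (bas j) = (i == j)%:R.
Proof. by rewrite /crd /bas coord_free ?(basis_free (vbasisP _)) // eq_sym. Qed.

Fact symU_is_linear : linear symU.
Proof.
move=> a u v; rewrite /symU scaler_sumr -big_split /=; apply: eq_bigr => i _.
by rewrite crd_is_scalar scalerDl scalerA.
Qed.
HB.instance Definition _ := GRing.isLinear.Build K U (SymAlg K U) _ symU symU_is_linear.

Lemma symU_bas i : symU (bas i) = 'X_i.
Proof.
rewrite /symU (bigD1 i) //= crd_bas eqxx scale1r big1 ?addr0 // => j nij.
by rewrite crd_bas (negPf nij) scale0r.
Qed.

End SymmetricAlgebra.

Lemma symU_universal (K : fieldType) (U : vectType K) (A : comAlgType K)
    (g : {linear U -> A}) :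
  exists h : {lrmorphism SymAlg K U -> A},
    (forall u, h (symU u) = g u) /\
    (forall h' : {lrmorphism SymAlg K U -> A},
       (forall u, h' (symU u) = g u) -> forall p, h' p = h p).
Proof.
pose h0 : SymAlg K U -> A := mmap (in_alg A) (fun i => g (bas i)).
have h0Z : scalable h0.
  by move=> a p; rewrite /h0 mmapZ /= -scalerAl mul1r.
have h0D : additive h0 by move=> p q; rewrite /h0 raddfB.
have h0M : monoid_morphism h0 by split=> [|p q]; rewrite /h0 ?rmorph1 ?rmorphM.
pose H : {lrmorphism SymAlg K U -> A} := HB.pack h0
  (GRing.isZmodMorphism.Build _ _ h0 h0D)
  (GRing.isMonoidMorphism.Build _ _ h0 h0M)
  (GRing.isScalable.Build _ _ _ _ h0 h0Z).
have HX i : H 'X_i = g (bas i) by rewrite /= /h0 mmapX mmap1U.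
exists H; split=> [u|h' h'E p].
  rewrite /symU linear_sum {2}(crd_sum u) linear_sum.
  by apply: eq_bigr => i _; rewrite !linearZ; congr (_ *: _); exact: HX.
rewrite (mpolyE p) !linear_sum; apply: eq_bigr => m _; rewrite !linearZ.
congr (_ *: _); rewrite mpolyXE_id (rmorph_prod h') (rmorph_prod H).
apply: eq_bigr => i _; rewrite (rmorphXn h') (rmorphXn H).
by congr (_ ^+ _); rewrite -symU_bas -[LHS]/(h' _) h'E symU_bas; exact/esym/HX.
Qed.

Section GradedDual.
Variables (K : fieldType) (U : vectType K).

(* The restricted graded dual \bigoplus_r R_r^* of R = Sym(U), realized as the
   space of the linear functionals on R that vanish on R_r for all large r. *)
Definition gdual_pred : {pred SymAlg K U -> K^o} := fun f =>
  `[< linear f /\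
      exists N, forall r p, (N <= r)%N -> p \is r.-homog -> f p = 0 >].

Fact gdual_submod_closed : GRing.submod_closed gdual_pred.
Proof.
split=> [|a f g /asboolP[lf [N fN]] /asboolP[lg [M gM]]]; apply/asboolP.
  by split=> [b x y|]; [rewrite scaler0 addr0 | exists 0%N].
have E x : (a *: f + g) x = a *: f x + g x by [].
split=> [b x y|].
  by rewrite !E lf lg !scalerDr !scalerA mulrC !addrA; congr (_ + _);
     rewrite -!addrA; congr (_ + _); rewrite addrC.
exists (maxn N M) => r p; rewrite geq_max => /andP[Nr Mr] hp.
by rewrite E (fN r) // (gM r) // scaler0 addr0.
Qed.
HB.instance Definition _ :=
  GRing.isSubmodClosed.Build K (SymAlg K U -> K^o) gdual_pred gdual_submod_closed.

Record gdual := GDual {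
  gdual_fun :> SymAlg K U -> K^o; _ : gdual_fun \in gdual_pred }.
HB.instance Definition _ := [isSub for gdual_fun].
HB.instance Definition _ := [Choice of gdual by <:].
HB.instance Definition _ := [SubChoice_isSubLmodule of gdual by <:].

Lemma gdualP (f g : gdual) : (forall p, f p = g p) -> f = g.
Proof. by move=> fg; apply: val_inj; apply: funext. Qed.

Lemma gdual_linearE (a : K) (f g : gdual) p : (a *: f + g) p = a * f p + g p.
Proof. by []. Qed.

Lemma gdual_fun_linear (f : gdual) : linear f.
Proof. by have /asboolP[] := valP f. Qed.
HB.instance Definition _ (f : gdual) :=
  GRing.isLinear.Build K (SymAlg K U) K^o _ (gdual_fun f) (gdual_fun_linear f).

Lemma gdual_bound (f : gdual) :
  exists N, forall r p, (N <= r)%N -> p \is r.-homog -> f p = 0.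
Proof. by have /asboolP[] := valP f. Qed.

Lemma gdual0 (p : SymAlg K U) : (0 : gdual) p = 0.
Proof. by []. Qed.

Lemma gdual_sumE (I : Type) (s : seq I) (F : I -> gdual) p :
  (\sum_(i <- s) F i) p = \sum_(i <- s) F i p.
Proof.
elim: s => [|i s IH]; first by rewrite !big_nil.
by rewrite !big_cons -IH.
Qed.

(* D_r = R_r^*: the functionals supported in degree r. *)
Definition gdual_gr (r : nat) : {pred gdual} := fun f =>
  `[< forall s p, s != r -> p \is s.-homog -> f p = 0 >].

Fact gdual_gr_submod_closed r : GRing.submod_closed (gdual_gr r).
Proof.
split=> [|a f g /asboolP fr /asboolP gr]; apply/asboolP => // s p sr hp.
by rewrite gdual_linearE (fr s) // (gr s) // mulr0 addr0.
Qed.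
HB.instance Definition _ r :=
  GRing.isSubmodClosed.Build K gdual (gdual_gr r) (gdual_gr_submod_closed r).

Fact contract_subproof (p : SymAlg K U) (f : gdual) :
  ((fun q => f (p * q)) : SymAlg K U -> K^o) \in gdual_pred.
Proof.
apply/asboolP; split=> [a x y|]; first by rewrite mulrDr -scalerAr linearP.
have [N fN] := gdual_bound f; exists N => r q Nr hq.
rewrite {1}[p]mpolyE mulr_suml linear_sum /= big1 // => m _.
rewrite -scalerAl linearZ /= (fN (mdeg m + r)%N) ?scaler0 //.
  exact: leq_trans Nr (leq_addl _ _).
by apply: dhomogM => //; rewrite dhomogX.
Qed.

(* The contraction action of R on D: <p', p o f> = <p p', f>. *)
Definition contract (p : SymAlg K U) (f : gdual) : gdual :=
  GDual (contract_subproof p f).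

Fact contract_is_linear p : linear (contract p).
Proof. by move=> a f g; apply: gdualP. Qed.
HB.instance Definition _ p :=
  GRing.isLinear.Build K gdual gdual _ (contract p) (contract_is_linear p).

Lemma contractA p q f : contract p (contract q f) = contract (p * q) f.
Proof. by apply: gdualP => x /=; rewrite mulrA (mulrC q). Qed.

Lemma contract1 f : contract 1 f = f.
Proof. by apply: gdualP => x /=; rewrite mul1r. Qed.

Lemma contract_linearl a p q f :
  contract (a *: p + q) f = a *: contract p f + contract q f.
Proof.
apply: gdualP => x; rewrite gdual_linearE /=.
by rewrite mulrDl -scalerAl linearP.
Qed.

End GradedDual.

Section AlternatingForms.
Variables (K : fieldType) (U : vectType K) (V : lmodType K) (q : nat).

Definition upd (u : {ffun 'I_q -> U}) (i : 'I_q) (x : U) : {ffun 'I_q -> U} :=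
  [ffun j => if j == i then x else u j].

Definition alt_pred : {pred {ffun 'I_q -> U} -> V} := fun f =>
  `[< (forall u i, linear (fun x => f (upd u i x))) /\
      (forall (u : {ffun 'I_q -> U}) i j, i != j -> u i = u j -> f u = 0) >].

Fact alt_submod_closed : GRing.submod_closed alt_pred.
Proof.
split=> [|a f g /asboolP[lf af] /asboolP[lg ag]]; apply/asboolP.
  by split=> // u i b x y; rewrite scaler0 addr0.
have E u : (a *: f + g) u = a *: f u + g u by [].
split=> [u i b x y|u i j ij uij]; last by rewrite E (af u i j) // (ag u i j) // scaler0 addr0.
rewrite !E (lf u i) (lg u i) !scalerDr !scalerA mulrC -!addrA; congr (_ + _).
by rewrite addrCA.
Qed.
HB.instance Definition _ := GRing.isSubmodClosed.Build K
  ({ffun 'I_q -> U} -> V) alt_pred alt_submod_closed.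

(* V (x) Lambda^q U^*, realized as the space of the V-valued alternating
   q-linear forms on U (U is finite-dimensional). *)
Record alt_of (phV : phant V) := Alt {
  alt_fun :> {ffun 'I_q -> U} -> V; _ : alt_fun \in alt_pred }.
Arguments Alt phV {alt_fun}.
Local Notation alt := (alt_of (Phant V)).
HB.instance Definition _ phV := [isSub of alt_of phV for @alt_fun phV].
HB.instance Definition _ phV := [Choice of alt_of phV by <:].
HB.instance Definition _ phV := [SubChoice_isSubLmodule of alt_of phV by <:].

Lemma altP (f g : alt) : (forall u, f u = g u) -> f = g.
Proof. by move=> fg; apply: val_inj; apply: funext. Qed.

Lemma alt_linearE (a : K) (f g : alt) u : (a *: f + g) u = a *: f u + g u.
Proof. by []. Qed.

Lemma alt_funP (f : alt) : alt_fun f \in alt_pred.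
Proof. by case: f. Qed.

Lemma alt_multilinear (f : alt) u i : linear (fun x => f (upd u i x)).
Proof. by have /asboolP[fl _] := alt_funP f; apply: fl. Qed.

Lemma alt_alternating (f : alt) (u : {ffun 'I_q -> U}) i j :
  i != j -> u i = u j -> f u = 0.
Proof. by have /asboolP[_] := alt_funP f; apply. Qed.

(* S (x) Lambda^q U^*, for a subspace S of V *)
Definition alt_in (S : {pred V}) : {pred alt} := fun f => `[< forall u, f u \in S >].

Fact alt_in_submod_closed (S : submodClosed V) : GRing.submod_closed (alt_in S).
Proof.
split=> [|a f g /asboolP fS /asboolP gS]; apply/asboolP => u; first exact: rpred0.
by rewrite alt_linearE rpredD ?rpredZ.
Qed.
HB.instance Definition _ (S : submodClosed V) :=
  GRing.isSubmodClosed.Build K alt (alt_in S) (alt_in_submod_closed S).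

Lemma upd_id u i : upd u i (u i) = u.
Proof. by apply/ffunP => j; rewrite ffunE; case: eqP => [->|]. Qed.

Lemma alt_upd0 (f : alt) u i : f (upd u i 0) = 0.
Proof.
have := alt_multilinear f u i 1 0 0.
by rewrite !scale1r addr0 => /eqP; rewrite -subr_eq subrr => /eqP.
Qed.

Lemma alt_updD (f : alt) u i x y :
  f (upd u i (x + y)) = f (upd u i x) + f (upd u i y).
Proof. by have := alt_multilinear f u i 1 x y; rewrite !scale1r. Qed.

Lemma alt_tperm (f : alt) (u : {ffun 'I_q -> U}) i j : i != j ->
  f [ffun k => u (tperm i j k)] = - f u.
Proof.
move=> ij; pose w x y := upd (upd u i x) j y.
have w0 x : f (w x x) = 0.
  by apply: (@alt_alternating f _ i j ij); rewrite !ffunE !eqxx (negPf ij).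
have wD x y z : f (w (x + y) z) = f (w x z) + f (w y z).
  have wE t : w t z = upd (upd u j z) i t.
    apply/ffunP => k; rewrite !ffunE; case: (k =P j) => // ->.
    by rewrite eq_sym (negPf ij).
  by rewrite !wE alt_updD.
have := w0 (u i + u j); rewrite wD /w !alt_updD -!/(w _ _) !w0 add0r addr0.
have -> : w (u i) (u j) = u by rewrite /w upd_id upd_id.
have -> : w (u j) (u i) = [ffun k => u (tperm i j k)].
  apply/ffunP => k; rewrite !ffunE; case: tpermP => [->|->|/eqP/negPf-> /eqP/negPf-> //].
    by rewrite (negPf ij) eqxx.
  by rewrite eqxx.
by move/eqP; rewrite addrC addr_eq0 => /eqP.
Qed.

Lemma alt_perm (f : alt) (s : {perm 'I_q}) (u : {ffun 'I_q -> U}) :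
  f [ffun k => u (s k)] = (-1) ^+ odd_perm s *: f u.
Proof.
have [ts -> /allP dts] := prod_tpermP s; elim: ts dts u => [|t ts IH] dts u.
  rewrite big_nil odd_perm1 scale1r; congr (alt_fun f _).
  by apply/ffunP => k; rewrite ffunE perm1.
have dt : t.1 != t.2 by apply: (dts t); rewrite inE eqxx.
rewrite big_cons odd_mul_tperm dt.
have -> : [ffun k => u ((tperm t.1 t.2 * \prod_(i <- ts) tperm i.1 i.2)%g k)]
   = [ffun k => [ffun k => u ((\prod_(i <- ts) tperm i.1 i.2)%g k)] (tperm t.1 t.2 k)].
  by apply/ffunP => k; rewrite !ffunE permM.
rewrite alt_tperm // IH; last by move=> x xts; apply: dts; rewrite inE xts orbT.
by rewrite -scaleNr; congr (_ *: _); rewrite addTb signrN.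
Qed.

End AlternatingForms.

Notation alt U V q := (@alt_of _ U _ q (Phant V)).

Section AltMap.
Variables (K : fieldType) (U : vectType K) (V W : lmodType K) (q : nat).
Variable g : {linear V -> W}.

Fact alt_map_subproof (f : alt U V q) : (g \o f) \in @alt_pred K U W q.
Proof.
apply/asboolP; split=> [u i a x y|u i j ij uij] /=.
  by rewrite alt_multilinear linearP.
by rewrite (alt_alternating f ij uij) linear0.
Qed.

(* g (x) id : V (x) Lambda^q U^* -> W (x) Lambda^q U^* *)
Definition alt_map (f : alt U V q) : alt U W q := Alt _ (alt_map_subproof f).

Fact alt_map_is_linear : linear alt_map.
Proof. by move=> a x y; apply: altP => u; rewrite alt_linearE /= -linearP. Qed.
HB.instance Definition _ :=
  GRing.isLinear.Build K (alt U V q) (alt U W q) _ alt_map alt_map_is_linear.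

End AltMap.

Section Koszul.
Variables (K : fieldType) (U : vectType K).

Definition omit (q : nat) (u : {ffun 'I_q.+1 -> U}) (i : 'I_q.+1) :
    {ffun 'I_q -> U} := [ffun j => u (lift i j)].

Definition koszul_fun q (f : alt U (gdual U) q) (u : {ffun 'I_q.+1 -> U}) :
    gdual U :=
  \sum_(i < q.+1) (-1) ^+ i *: contract (symU (u i)) (f (omit u i)).

Lemma omit_upd q (u : {ffun 'I_q.+1 -> U}) i x : omit (upd u i x) i = omit u i.
Proof. by apply/ffunP => j; rewrite !ffunE eq_sym (negPf (neq_lift _ _)). Qed.

Lemma omit_upd_lift q (u : {ffun 'I_q.+1 -> U}) i k x :
  omit (upd u (lift i k) x) i = upd (omit u i) k x.
Proof. by apply/ffunP => j; rewrite !ffunE (inj_eq lift_inj). Qed.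

Lemma omit_perm q (u : {ffun 'I_q.+1 -> U}) a b : a != b -> u a = u b ->
  exists2 s : {perm 'I_q}, odd_perm s = odd a (+) odd b (+) true &
    omit u a = [ffun k => omit u b (s k)].
Proof.
move=> ab uab.
have tb j : b != tperm a b (lift a j).
  by rewrite -{1}(tpermL a b) (inj_eq perm_inj) neq_lift.
pose g j := odflt j (unlift b (tperm a b (lift a j))).
have gE j : lift b (g j) = tperm a b (lift a j).
  by rewrite /g; case: (unlift_some (tb j)) => k -> ->.
have g_inj : injective g.
  by move=> i j /(congr1 (lift b)); rewrite !gE => /perm_inj /lift_inj.
exists (perm g_inj).
  have : lift_perm a b (perm g_inj) = tperm a b.
    apply/permP => k; have [->|[j ->]] : k = a \/ exists j, k = lift a j.
    - by case: (unliftP a k) => [j ->|->]; [right; exists j | left].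
    - by rewrite lift_perm_id tpermL.
    - by rewrite lift_perm_lift permE gE.
  move/(congr1 (@odd_perm _)); rewrite odd_lift_perm odd_tperm ab.
  by case: (odd a); case: (odd b); case: (odd_perm _).
apply/ffunP => j; rewrite !ffunE permE gE.
by case: tpermP => [->|->|].
Qed.

Fact koszul_subproof q (f : alt U (gdual U) q) :
  koszul_fun f \in @alt_pred K U (gdual U) q.+1.
Proof.
apply/asboolP; split=> [u i a x y|u a b ab uab]; rewrite /koszul_fun.
  rewrite scaler_sumr -big_split /=; apply: eq_bigr => j _.
  case: (unliftP j i) => [k ->|->].
    rewrite !omit_upd_lift alt_multilinear linearP /= scalerDr !scalerA mulrC.
    by rewrite /upd !ffunE (negPf (neq_lift _ _)).
  rewrite !omit_upd /upd !ffunE !eqxx linearP /= contract_linearl.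
  by rewrite scalerDr !scalerA mulrC.
rewrite (bigD1 a) //= (bigD1 b) 1?eq_sym //= big1 => [|i /andP[ia ib]].
  have [s so ->] := omit_perm ab uab.
  rewrite addr0 alt_perm uab so linearZ /= scalerA -signr_odd -[in X in _ + X]signr_odd.
  rewrite -scalerDl -!signr_addb.
  by case: (odd a); case: (odd b); rewrite /= ?expr0 ?expr1 ?subrr ?addNr ?addrN scale0r.
case: (unliftP i a) ia ab uab => [k -> _|->]; last by rewrite eqxx.
case: (unliftP i b) ib => [l -> _|->]; last by rewrite eqxx.
rewrite (inj_eq lift_inj) => kl ukl.
by rewrite (@alt_alternating _ _ _ _ f _ k l kl) ?linear0 ?scaler0 // !ffunE.
Qed.

(* delta : D (x) Lambda^q U^* -> D (x) Lambda^{q+1} U^* *)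
Definition koszul q (f : alt U (gdual U) q) : alt U (gdual U) q.+1 :=
  Alt _ (koszul_subproof f).

Fact koszul_is_linear q : linear (@koszul q).
Proof.
move=> a f g; apply: altP => u; rewrite alt_linearE.
rewrite -[LHS]/(koszul_fun _ _) -![alt_fun (koszul _) _]/(koszul_fun _ _).
rewrite /koszul_fun scaler_sumr -big_split; apply: eq_bigr => j _.
by rewrite alt_linearE linearP /= scalerDr !scalerA mulrC.
Qed.
HB.instance Definition _ q := GRing.isLinear.Build K
  (alt U (gdual U) q) (alt U (gdual U) q.+1) _ (@koszul q) (@koszul_is_linear q).

(* The R-action on D (x) Lambda^q U^*, through the factor D. *)
Definition form_act q (p : SymAlg K U) : alt U (gdual U) q -> alt U (gdual U) q :=
  alt_map (contract p).

Lemma koszul_act q p (f : alt U (gdual U) q) :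
  koszul (form_act p f) = form_act p (koszul f).
Proof.
apply: altP => u; rewrite /= /koszul_fun linear_sum; apply: eq_bigr => j _.
by rewrite /= linearZ /= !contractA mulrC.
Qed.

(* D_r (x) Lambda^q U^* *)
Definition form_gr q r : submodClosed (alt U (gdual U) q) := alt_in (gdual_gr r).

Definition closed_forms q : {pred alt U (gdual U) q} := fun f => koszul f == 0.

Fact closed_forms_submod_closed q : GRing.submod_closed (@closed_forms q).
Proof.
split=> [|a f g /eqP f0 /eqP g0]; apply/eqP; first exact: linear0.
by rewrite linearP /= f0 g0 scaler0 addr0.
Qed.
HB.instance Definition _ q := GRing.isSubmodClosed.Build K
  (alt U (gdual U) q) (@closed_forms q) (@closed_forms_submod_closed q).

Definition Z2 : {pred alt U (gdual U) 2} := @closed_forms 2.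
HB.instance Definition _ := GRing.SubmodClosed.on Z2.

Definition Z2_gr r : {pred alt U (gdual U) 2} :=
  fun f => (f \in Z2) && (f \in form_gr 2 r).

Fact Z2_gr_submod_closed r : GRing.submod_closed (Z2_gr r).
Proof.
split=> [|a f g /andP[fZ fr] /andP[gZ gr]]; apply/andP.
  by rewrite !rpred0.
by split; rewrite rpredD ?rpredZ.
Qed.
HB.instance Definition _ r := GRing.isSubmodClosed.Build K
  (alt U (gdual U) 2) (Z2_gr r) (Z2_gr_submod_closed r).

(* The subspace delta(D_{r+1} (x) Lambda^q U^* ) of D_r (x) Lambda^{q+1} U^*;
   for q = 0 this is delta(D_{r+1}). *)
Definition exact_forms q r : {pred subm (form_gr q.+1 r)} := fun f =>
  `[< exists2 g : alt U (gdual U) q,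
        g \in form_gr q r.+1 & subm_val f = koszul g >].

Fact exact_forms_submod_closed q r : GRing.submod_closed (@exact_forms q r).
Proof.
split=> [|a f1 f2 /asboolP[g1 g1r e1] /asboolP[g2 g2r e2]]; apply/asboolP.
  by exists 0; rewrite ?rpred0 // linear0.
exists (a *: g1 + g2); first by rewrite rpredD ?rpredZ.
by rewrite linearP /= -e1 -e2.
Qed.
HB.instance Definition _ q r := GRing.isSubmodClosed.Build K
  (subm (form_gr q.+1 r)) (@exact_forms q r) (@exact_forms_submod_closed q r).

End Koszul.

Lemma koszul2E (K : fieldType) (U : vectType K) (Phi : alt U (gdual U) 2) (u v w : U) :
  let a2 x y : {ffun 'I_2 -> U} := [ffun i => tnth [tuple x; y] i] in
  koszul Phi [ffun i => tnth [tuple u; v; w] i] =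
    contract (symU u) (Phi (a2 v w)) - contract (symU v) (Phi (a2 u w))
    + contract (symU w) (Phi (a2 u v)).
Proof.
move=> a2; set t := [ffun i => _].
have e0 : omit t 0 = a2 v w.
  by apply/ffunP => -[[|[|]]] //= ?; rewrite !ffunE !(tnth_nth 0).
have e1 : omit t 1 = a2 u w.
  by apply/ffunP => -[[|[|]]] //= ?; rewrite !ffunE !(tnth_nth 0).
have e2 : omit t 2%:R = a2 u v.
  by apply/ffunP => -[[|[|]]] //= ?; rewrite !ffunE !(tnth_nth 0).
rewrite /= /koszul_fun !big_ord_recl big_ord0 addr0.
rewrite (_ : lift ord0 (lift ord0 ord0) = 2%:R); last exact: val_inj.
rewrite (_ : lift ord0 ord0 = 1); last exact: val_inj.
rewrite e0 e1 e2 !ffunE !(tnth_nth 0) /=.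
by rewrite expr0 scale1r expr1 scaleN1r sqrrN expr1n scale1r addrA.
Qed.

(* V (x) U: by the basis of U, a tensor is a family of components in V;
   universality is [tens_universal]. *)
Notation tens V U := {ffun 'I_(\dim (fullv : {vspace U})) -> V}.

Section TensorWithU.
Variables (K : fieldType) (U : vectType K) (V : lmodType K).

Definition tensor (v : V) (u : U) : tens V U := [ffun i => crd i u *: v].

Lemma tensor_linearl u : linear (tensor^~ u).
Proof. by move=> a x y; apply/ffunP => i; rewrite !ffunE linearP. Qed.

Lemma tensor_linearr v : linear (tensor v).
Proof.
move=> a x y; apply/ffunP => i.
by rewrite !ffunE crd_is_scalar scalerDl scalerA.
Qed.

Lemma tens_sum (t : tens V U) : t = \sum_i tensor (t i) (bas i).
Proof.
apply/ffunP => i; rewrite sum_ffunE (bigD1 i) //= big1 => [|j ji].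
  by rewrite ffunE crd_bas eqxx scale1r addr0.
by rewrite ffunE crd_bas eq_sym (negPf ji) scale0r.
Qed.

Definition tens_in (S : {pred V}) : {pred tens V U} :=
  fun t => [forall i, t i \in S].

Fact tens_in_submod_closed (S : submodClosed V) :
  GRing.submod_closed (tens_in S).
Proof.
split=> [|a x y /forallP xS /forallP yS]; apply/forallP => i; rewrite !ffunE.
  exact: rpred0.
by rewrite rpredD ?rpredZ.
Qed.
HB.instance Definition _ (S : submodClosed V) :=
  GRing.isSubmodClosed.Build K (tens V U) (tens_in S) (tens_in_submod_closed S).

End TensorWithU.

Lemma tens_universal (K : fieldType) (U : vectType K) (V W : lmodType K)
    (b : V -> U -> W) :
  (forall u, linear (b^~ u)) -> (forall v, linear (b v)) ->
  exists h : {linear tens V U -> W},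
    (forall v u, h (tensor v u) = b v u) /\
    (forall h' : {linear tens V U -> W},
       (forall v u, h' (tensor v u) = b v u) -> forall t, h' t = h t).
Proof.
move=> bl br; pose h (t : tens V U) := \sum_i b (t i) (bas i).
have hl : linear h.
  move=> a x y; rewrite /h scaler_sumr -big_split /=; apply: eq_bigr => i _.
  by rewrite !ffunE bl.
pose hL := GRing.isLinear.Build K (tens V U) W _ h hl.
pose H : {linear tens V U -> W} := HB.pack h hL.
have HE t : H t = \sum_i b (t i) (bas i) by [].
exists H; split=> [v u|h' h'E t].
  pose brL := GRing.isLinear.Build K U W _ (b v) (br v).
  pose B : {linear U -> W} := HB.pack (b v) brL.
  rewrite HE -[RHS]/(B u) {2}(crd_sum u) linear_sum; apply: eq_bigr => i _.
  rewrite linearZ ffunE /=.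
  pose blL := GRing.isLinear.Build K V W _ (b^~ (bas i)) (bl (bas i)).
  pose B' : {linear V -> W} := HB.pack (b^~ (bas i)) blL.
  by rewrite -[LHS]/(B' (crd i u *: v)) linearZ.
by rewrite HE {1}(tens_sum t) linear_sum; apply: eq_bigr => i _; rewrite h'E.
Qed.

Section TensMap.
Variables (K : fieldType) (U : vectType K) (V W : lmodType K).
Variable g : {linear V -> W}.

(* g (x) id : V (x) U -> W (x) U *)
Definition tens_map (t : tens V U) : tens W U := [ffun i => g (t i)].

Fact tens_map_is_linear : linear tens_map.
Proof. by move=> a x y; apply/ffunP => i; rewrite !ffunE linearP. Qed.
HB.instance Definition _ :=
  GRing.isLinear.Build K (tens V U) (tens W U) _ tens_map tens_map_is_linear.

Lemma tens_map_tensor v u : tens_map (tensor v u) = tensor (g v) u.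
Proof. by apply/ffunP => i; rewrite !ffunE linearZ. Qed.

End TensMap.

(* x (x) omega, for x in V and omega in Lambda^q U^* *)
Section AltTensor.
Variables (K : fieldType) (U : vectType K) (V : lmodType K) (q : nat).

Fact alt_tensor_subproof (x : V) (w : alt U K^o q) :
  ((fun u => (w u : K) *: x) : {ffun 'I_q -> U} -> V) \in @alt_pred K U V q.
Proof.
apply/asboolP; split=> [u i a y z|u i j ij uij].
  by rewrite alt_multilinear scalerDl scalerA.
by rewrite (alt_alternating w ij uij) scale0r.
Qed.

Definition alt_tensor (x : V) (w : alt U K^o q) : alt U V q :=
  Alt (Phant V) (alt_tensor_subproof x w).

End AltTensor.

Section Contraction.
Variables (K : fieldType) (U : vectType K) (V : lmodType K) (q : nat).

Definition fcons (x : U) (v : {ffun 'I_q -> U}) : {ffun 'I_q.+1 -> U} :=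
  [ffun j => if unlift ord0 j is Some k then v k else x].

Lemma fcons_upd x (v : {ffun 'I_q -> U}) i y :
  fcons x (upd v i y) = upd (fcons x v) (lift ord0 i) y.
Proof.
apply/ffunP => j; rewrite !ffunE; case: unliftP => [k ->|->].
  by rewrite !ffunE (inj_eq lift_inj).
by rewrite (negPf (neq_lift _ _)).
Qed.

Fact contraction_subproof (Psi : alt U (tens V U) q.+1) :
  ((fun v => \sum_i (Psi (fcons (bas i) v)) i) : {ffun 'I_q -> U} -> V)
    \in @alt_pred K U V q.
Proof.
apply/asboolP; split=> [u i a y z|u i j ij uij].
  rewrite scaler_sumr -big_split /=; apply: eq_bigr => k _.
  by rewrite !fcons_upd alt_multilinear !ffunE.
apply: big1 => k _.
have lij : lift ord0 i != lift ord0 j by rewrite (inj_eq lift_inj).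
by rewrite (alt_alternating Psi lij) ?ffunE // !liftK.
Qed.

(* The contraction V (x) U (x) Lambda^{q+1} U^* -> V (x) Lambda^q U^*, sending
   x (x) u (x) omega to x (x) omega(u, -): it is the trace of the first
   argument of the form against the factor U ([contraction_tensor]). *)
Definition contraction (Psi : alt U (tens V U) q.+1) : alt U V q :=
  Alt (Phant V) (contraction_subproof Psi).

Fact contraction_is_linear : linear contraction.
Proof.
move=> a f g; apply: altP => u; rewrite alt_linearE /=.
rewrite scaler_sumr -big_split; apply: eq_bigr => j _.
by rewrite -[X in X = _]/(((a *: f + g) (fcons (bas j) u)) j) alt_linearE !ffunE.
Qed.
HB.instance Definition _ := GRing.isLinear.Build K
  (alt U (tens V U) q.+1) (alt U V q) _ contraction contraction_is_linear.

Lemma contraction_tensor x u (w : alt U K^o q.+1) v :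
  contraction (alt_tensor (tensor x u) w) v = w (fcons u v) *: x.
Proof.
have fconsl : linear ((fun y => w (fcons y v)) : U -> K^o).
  move=> a y z; have E t : fcons t v = upd (fcons u v) ord0 t.
    apply/ffunP => j; rewrite !ffunE; case: (unliftP ord0 j) => [k ->|->].
      by rewrite eq_sym (negPf (neq_lift _ _)).
    by rewrite eqxx.
  by rewrite (E (a *: y + z)) (E y) (E z) alt_multilinear.
pose wL := GRing.isLinear.Build K U K^o _ _ fconsl.
pose W : {linear U -> K^o} := HB.pack (fun y => w (fcons y v)) wL.
rewrite -[X in X *: x]/(W u) {2}(crd_sum u) linear_sum scaler_suml.
apply: eq_bigr => i _; rewrite linearZ /= !ffunE scalerA.
by rewrite mulrC.
Qed.

End Contraction.

Section Divergence.
Variables (K : fieldType) (U : vectType K).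

(* D (x) U -> D, f (x) u |-> u o f *)
Definition divU (t : tens (gdual U) U) : gdual U :=
  \sum_i contract (symU (bas i)) (t i).

Fact divU_is_linear : linear divU.
Proof.
move=> a x y; rewrite /divU scaler_sumr -big_split /=; apply: eq_bigr => i _.
by rewrite !ffunE linearP.
Qed.
HB.instance Definition _ :=
  GRing.isLinear.Build K (tens (gdual U) U) (gdual U) _ divU divU_is_linear.

Lemma divU_tensor f u : divU (tensor f u) = contract (symU u) f.
Proof.
apply: gdualP => p; rewrite /divU {2}(crd_sum u).
rewrite linear_sum /= mulr_suml linear_sum /=.
rewrite gdual_sumE.
by apply: eq_bigr => i _; rewrite ffunE linearZ linearZ /= -scalerAl linearZ.
Qed.

(* div : D (x) U (x) Lambda^3 U^* -> D (x) Lambda^3 U^* *)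
Definition div3 : alt U (tens (gdual U) U) 3 -> alt U (gdual U) 3 :=
  alt_map divU.
HB.instance Definition _ := GRing.Linear.on div3.

Lemma div3_tensor f u (w : alt U K^o 3) :
  div3 (alt_tensor (tensor f u) w) = alt_tensor (contract (symU u) f) w.
Proof. by apply: altP => v; rewrite /= linearZ /= divU_tensor. Qed.

Definition ker_div3 : {pred alt U (tens (gdual U) U) 3} :=
  fun Psi => div3 Psi == 0.

Fact ker_div3_submod_closed : GRing.submod_closed ker_div3.
Proof.
split=> [|a f g /eqP f0 /eqP g0]; apply/eqP; first exact: linear0.
by rewrite linearP /= f0 g0 scaler0 addr0.
Qed.
HB.instance Definition _ := GRing.isSubmodClosed.Build K
  (alt U (tens (gdual U) U) 3) ker_div3 ker_div3_submod_closed.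

(* The R-action on D (x) U (x) Lambda^3 U^*, through the factor D. *)
Definition vf_act (p : SymAlg K U) :
    alt U (tens (gdual U) U) 3 -> alt U (tens (gdual U) U) 3 :=
  alt_map (tens_map (contract p)).

(* D_r (x) U (x) Lambda^3 U^* *)
Definition vf_gr (r : nat) : {pred alt U (tens (gdual U) U) 3} :=
  alt_in (tens_in (gdual_gr r)).

End Divergence.

(* Polynomial functions on U; here 'X_i is the coordinate function [crd i]. *)
Notation Pol K U := {mpoly K[\dim (fullv : {vspace U})]} (only parsing).

Section PolynomialVectorFields.
Variables (K : fieldType) (U : vectType K).

(* p(d), for p in Sym(U): the constant-coefficient differential operator in
   which u in U stands for the derivative along u. *)
Definition pol_diff (p : SymAlg K U) (g : Pol K U) : Pol K U :=
  \sum_(m <- msupp p) p@_m *: g^`M[m].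

Fact pol_diff_is_linear p : linear (pol_diff p).
Proof.
move=> a x y; rewrite /pol_diff scaler_sumr -big_split /=; apply: eq_bigr => m _.
by rewrite linearP /= scalerDr !scalerA mulrC.
Qed.
HB.instance Definition _ p :=
  GRing.isLinear.Build K (Pol K U) (Pol K U) _ (pol_diff p) (pol_diff_is_linear p).

Definition mfact (m : 'X_{1.. \dim {:U}}) : nat := (\prod_i (m i)`!)%N.

(* The polynomial function sum_m f(X^m) x^m / m! attached to f in D, i.e.
   u |-> f(u^r) / r! for f in D_r. *)
Definition gdual_pol (f : gdual U) : Pol K U :=
  \sum_(m : bmultinom (\dim {:U}) (sval (cid (gdual_bound f))))
    (f 'X_[m] / (mfact m)%:R) *: 'X_[m].

Lemma mcoeff_gdual_pol f m : (gdual_pol f)@_m = f 'X_[m] / (mfact m)%:R.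
Proof.
rewrite /gdual_pol; case: cid => N fN /=; have [mN|Nm] := ltnP (mdeg m) N.
  by rewrite (mcoeff_mpoly (fun m => f 'X_[m] / (mfact m)%:R)).
rewrite (fN (mdeg m)) ?dhomogX // mul0r raddf_sum big1 // => -[k kN] _ /=.
rewrite mcoeffZ mcoeffX; case: eqP => [km|_]; last by rewrite mulr0.
by rewrite km ltnNge Nm in kN.
Qed.

Fact gdual_pol_is_linear : linear gdual_pol.
Proof.
move=> a f g; apply/mpolyP => m.
by rewrite mcoeffD mcoeffZ !mcoeff_gdual_pol gdual_linearE mulrDl mulrA.
Qed.
HB.instance Definition _ :=
  GRing.isLinear.Build K (gdual U) (Pol K U) _ gdual_pol gdual_pol_is_linear.

(* The divergence sum_i dX_i/dx_i of a polynomial vector field, an element of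
   Pol (x) U. *)
Definition pol_divU (X : tens (Pol K U) U) : Pol K U := \sum_i (X i)^`M(i).

Fact pol_divU_is_linear : linear pol_divU.
Proof.
move=> a x y; rewrite /pol_divU scaler_sumr -big_split /=; apply: eq_bigr => i _.
by rewrite !ffunE linearP.
Qed.
HB.instance Definition _ :=
  GRing.isLinear.Build K (tens (Pol K U) U) (Pol K U) _ pol_divU pol_divU_is_linear.

(* Polynomial vector fields twisted by the determinant line Lambda^3 U^*. *)
Definition pol_div3 : alt U (tens (Pol K U) U) 3 -> alt U (Pol K U) 3 :=
  alt_map pol_divU.

Definition ker_pol_div3 : {pred alt U (tens (Pol K U) U) 3} :=
  fun X => pol_div3 X == 0.

Definition pol_vf_act (p : SymAlg K U) :
    alt U (tens (Pol K U) U) 3 -> alt U (tens (Pol K U) U) 3 :=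
  alt_map (tens_map (pol_diff p)).

Definition pol_vf_gr (r : nat) : {pred alt U (tens (Pol K U) U) 3} :=
  alt_in (tens_in (r.-homog : {pred Pol K U})).

Definition vf_pol : alt U (tens (gdual U) U) 3 -> alt U (tens (Pol K U) U) 3 :=
  alt_map (tens_map gdual_pol).
HB.instance Definition _ := GRing.Linear.on vf_pol.

End PolynomialVectorFields.

Section InverseSystems.
Variables (K : fieldType) (U : vectType K).

(* N is a finite-dimensional graded R-submodule of L, where L is a subspace of
   a space M graded by [gr] and acted upon by R = Sym(U) through [act]. *)
Definition fd_graded_submodule (M : lmodType K) (act : SymAlg K U -> M -> M)
    (gr : nat -> {pred M}) (L : {pred M}) (N : set M) : Prop :=
  [/\ forall x, N x -> x \in L,
      N 0 /\ forall (a : K) x y, N x -> N y -> N (a *: x + y),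
      forall p x, N x -> N (act p x),
      forall x, N x -> exists n (y : nat -> M),
        (forall r, N (y r) /\ y r \in gr r) /\ x = \sum_(r < n) y r
    & exists n (e : 'I_n -> M), forall x, N x ->
        exists c : 'I_n -> K, x = \sum_i c i *: e i].

Definition inverse_system : set (alt U (gdual U) 2) -> Prop :=
  fd_graded_submodule (@form_act K U 2) (form_gr U 2) (@Z2 K U).

Definition divfree_system : set (alt U (tens (gdual U) U) 3) -> Prop :=
  fd_graded_submodule (@vf_act K U) (@vf_gr K U) (@ker_div3 K U).

Definition divfree_pol_system : set (alt U (tens (Pol K U) U) 3) -> Prop :=
  fd_graded_submodule (@pol_vf_act K U) (@pol_vf_gr K U) (@ker_pol_div3 K U).

End InverseSystems.

(* Main.v *)
(* Transposing d/dX_i on Sym(U) gives operators on D whose commutator with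
   contraction by u in U is the i-th coordinate of u; summed against the
   contraction of forms by the basis of U they give a homotopy h with
   delta h + h delta = r + q on D_r (x) Lambda^q U^*, whence exactness of the
   Koszul complex in characteristic zero.  When dim U = q + 1, the contraction
   U (x) Lambda^{q+1} U^* -> Lambda^q U^* is inverse to the exterior
   multiplication by the canonical element of U (x) U^*, and delta is the
   divergence composed with the latter. *)
Require Import Defs.
From HB Require Import structures.
From mathcomp Require Import all_boot all_algebra.
From mathcomp Require Import perm.
From mathcomp Require Import boolp classical_sets functions.
From mathcomp Require Import generic_quotient ring_quotient mpoly.

Import GRing.Theory.
Local Open Scope classical_set_scope.
Local Open Scope ring_scope.

Set Implicit Arguments.
Unset Strict Implicit.
Unset Printing Implicit Defensive.

(** * Linear maps between subspaces and quotients *)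

Lemma inj_surj_bij (A B : Type) (f : A -> B) :
  injective f -> (forall y, exists x, f x = y) -> bijective f.
Proof.
move=> fI fS; have fK y : f (sval (cid (fS y))) = y by case: cid.
by exists (fun y => sval (cid (fS y))) => [x|//]; apply: fI.
Qed.

Lemma linear_inj0 (K : fieldType) (V W : lmodType K) (f : {linear V -> W}) :
  (forall x, f x = 0 -> x = 0) -> injective f.
Proof. by move=> f0 x y /eqP; rewrite -subr_eq0 -linearB => /eqP/f0/subr0_eq. Qed.

Lemma subm_bij (K : fieldType) (V W : lmodType K) (S : submodClosed V)
    (T : submodClosed W) (f : {linear V -> W}) :
  bijective f -> (forall x, (x \in S) = (f x \in T)) ->
  exists phi : {linear subm S -> subm T},
    bijective phi /\ forall x, subm_val (phi x) = f (subm_val x).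
Proof.
move=> [g fK gK] fST.
have fT (x : subm S) : f (subm_val x) \in T by rewrite -fST; apply: valP x.
have gS (y : subm T) : g (subm_val y) \in S.
  by rewrite fST gK; apply: valP y.
have phil : linear (fun x => Subm (fT x)).
  by move=> a x y; apply: val_inj; rewrite /= linearP.
pose phiL := GRing.isLinear.Build K (subm S) (subm T) _ _ phil.
pose phi : {linear subm S -> subm T} := HB.pack (fun x => Subm (fT x)) phiL.
exists phi; split=> //; exists (fun y => Subm (gS y)) => x; apply: val_inj.
  exact: fK.
exact: gK.
Qed.

Lemma quotm_first_iso (K : fieldType) (V W : lmodType K) (S : submodClosed V)
    (f : {linear V -> W}) :
  (forall x, (x \in S) = (f x == 0)) -> (forall y, exists x, f x = y) ->
  exists phi : {linear quotm S -> W},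
    bijective phi /\ forall x, phi (quotm_pi S x) = f x.
Proof.
(* Evaluating f at the chosen representative is harmless: two representatives differ by an element
   of S, which f kills. *)
move=> fker fS; pose phi0 (x : quotm S) := f (repr x).
have phiE x : phi0 (quotm_pi S x) = f x.
  by apply/subr0_eq/eqP; rewrite -linearB -fker; apply/quotm_piE/quotm_repr.
have phil : linear phi0.
  move=> a x y; have [v ->] := quotm_pi_surj x; have [w ->] := quotm_pi_surj y.
  by rewrite -linearP !phiE linearP.
pose phiL := GRing.isLinear.Build K (quotm S) W _ _ phil.
pose phi : {linear quotm S -> W} := HB.pack phi0 phiL.
exists phi; split=> //; apply: inj_surj_bij => [|y].
  apply: linear_inj0 => x; have [v ->] := quotm_pi_surj x.
  rewrite [LHS]phiE => /eqP; rewrite -fker => vS.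
  by rewrite -[RHS](linear0 (quotm_pi S)); apply/quotm_piE; rewrite subr0.
by have [x <-] := fS y; exists (quotm_pi S x); apply: phiE.
Qed.

(** * Transport of graded submodules along an isomorphism *)

Section Transport.
Variables (K : fieldType) (U : vectType K) (M M' : lmodType K).
Variables (act : SymAlg K U -> M -> M) (gr : nat -> {pred M}) (L : {pred M}).
Variables (act' : SymAlg K U -> M' -> M') (gr' : nat -> {pred M'}) (L' : {pred M'}).
Variable F : {linear M' -> M}.
Hypothesis Fbij : bijective F.
Hypothesis actF : forall p x, F (act' p x) = act p (F x).
Hypothesis grF : forall r x, (x \in gr' r) = (F x \in gr r).
Hypothesis LF : forall x, (x \in L') = (F x \in L).

(** Applied twice below, along [contraction] and along [vf_pol]. Homogeneous components and finite
    spanning families are carried by F in one direction and by its inverse in the other. *)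
Lemma fd_graded_submodule_preim (N : set M) :
  fd_graded_submodule act gr L N <->
  fd_graded_submodule act' gr' L' [set x | N (F x)].
Proof.
case: Fbij => G FK GK; have FI := can_inj FK; split=> -[NL [N0 ND] NA NG [n [e Ne]]].
  split=> /=.
  - by move=> x /NL; rewrite LF.
  - by split=> [|a x y Nx Ny]; rewrite ?linear0 // linearP; apply: ND.
  - by move=> p x Nx; rewrite actF; apply: NA.
  - move=> x /NG[k [y [yP xE]]]; exists k, (G \o y); split=> [r|] /=.
      by rewrite grF GK; apply: yP.
    by apply: FI; rewrite xE linear_sum; apply: eq_bigr => i _; rewrite /= GK.
  - exists n, (G \o e) => x /Ne[c cE]; exists c; apply: FI; rewrite cE linear_sum.
    by apply: eq_bigr => i _; rewrite linearZ /= GK.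
have NF x : N x -> exists2 y, N (F y) & x = F y.
  by move=> Nx; exists (G x); rewrite GK.
split=> /=.
- by move=> x /NF[y Ny ->]; rewrite -LF; apply: NL.
- split=> [|a _ _ /NF[x Nx ->] /NF[y Ny ->]]; first by rewrite -(linear0 F).
  by rewrite -linearP; apply: ND.
- by move=> p _ /NF[x Nx ->]; rewrite -actF; apply: NA.
- move=> _ /NF[x Nx ->]; have [k [y [yP ->]]] := NG _ Nx.
  exists k, (F \o y); split=> [r|] /=; last by rewrite linear_sum.
  by rewrite -grF; apply: yP.
- exists n, (F \o e) => _ /NF[x Nx ->]; have [c ->] := Ne _ Nx.
  by exists c; rewrite linear_sum; apply: eq_bigr => i _; rewrite linearZ.
Qed.

End Transport.

(** * Alternating forms: basis expansion and interior products *)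

Section Forms.
Variables (K : fieldType) (U : vectType K) (V : lmodType K).
Local Notation n := (\dim {:U}).

Lemma alt_upd_sum q (f : alt U V q) u i (I : finType) (a : I -> K) (x : I -> U) :
  f (upd u i (\sum_j a j *: x j)) = \sum_j a j *: f (upd u i (x j)).
Proof.
pose gL := GRing.isLinear.Build K U V _ _ (alt_multilinear f u i).
pose g : {linear U -> V} := HB.pack (fun y => f (upd u i y)) gL.
rewrite -[LHS]/(g _) linear_sum; apply: eq_bigr => j _.
by rewrite linearZ.
Qed.

Lemma alt_upd_crd q (f : alt U V q) u i :
  f u = \sum_j crd j (u i) *: f (upd u i (bas j)).
Proof. by rewrite -alt_upd_sum -crd_sum upd_id. Qed.

Lemma alt_basis_eq0 q (f : alt U V q) :
  (forall g : 'I_q -> 'I_n, f [ffun k => bas (g k)] = 0) -> f = 0.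
Proof.
(* Induction on k, where only the arguments of index at least k are known to be basis vectors: k = 0
   is the hypothesis, k = q imposes no condition, and the step expands argument k in the basis. *)
move=> f0; suff fk k (u : {ffun 'I_q -> U}) :
    (forall j : 'I_q, (k <= j)%N -> exists i, u j = bas i) -> f u = 0.
  apply: Defs.altP => u; apply: (fk q) => j.
  by rewrite leqNgt ltn_ord.
elim: k u => [|k IH] u uk.
  have ub j : exists i, u j = bas i by apply: uk.
  rewrite -[RHS](f0 (fun j => sval (cid (ub j)))); congr (alt_fun f _).
  by apply/ffunP => j; rewrite ffunE; case: cid.
have [kq|qk] := ltnP k q; last first.
  by apply: IH => j; rewrite leqNgt (leq_trans (ltn_ord j) qk).
rewrite (alt_upd_crd f u (Ordinal kq)) big1 // => i _; rewrite IH ?scaler0 // => j.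
rewrite leq_eqVlt ffunE => /predU1P[kj|kj].
  by exists i; rewrite -(inj_eq val_inj) /= -kj eqxx.
by rewrite -(inj_eq val_inj) /= gtn_eqF //; apply: uk.
Qed.

Lemma fcons0 q x (v : {ffun 'I_q -> U}) : fcons x v ord0 = x.
Proof. by rewrite ffunE unlift_none. Qed.

Lemma fcons_lift q x (v : {ffun 'I_q -> U}) j : fcons x v (lift ord0 j) = v j.
Proof. by rewrite ffunE liftK. Qed.

Lemma omit_fcons0 q x (v : {ffun 'I_q -> U}) : omit (fcons x v) ord0 = v.
Proof. by apply/ffunP => j; rewrite ffunE fcons_lift. Qed.

Lemma omit_fcons_lift q x (v : {ffun 'I_q.+1 -> U}) j :
  omit (fcons x v) (lift ord0 j) = fcons x (omit v j).
Proof.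
apply/ffunP => k; case: (unliftP ord0 k) => [l ->|->].
  rewrite fcons_lift !ffunE -[X in unlift _ X](_ : lift ord0 (lift j l) = _) ?liftK //.
  by apply: val_inj; rewrite /= /bump /= !add1n ltnS addnS.
rewrite fcons0 ffunE -[X in fcons _ _ X](_ : ord0 = _) ?fcons0 //.
exact: val_inj.
Qed.

Lemma fcons_omit0 q (u : {ffun 'I_q.+1 -> U}) : fcons (u ord0) (omit u ord0) = u.
Proof.
by apply/ffunP => k; case: (unliftP ord0 k) => [l ->|->]; rewrite ?fcons_lift ?fcons0 ?ffunE.
Qed.

(** Bringing argument j to the front is a cycle of length j + 1, of sign (-1)^j. *)
Lemma alt_fcons_omit q (f : alt U V q.+1) (u : {ffun 'I_q.+1 -> U}) j :
  f (fcons (u j) (omit u j)) = (-1) ^+ j *: f u.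
Proof.
have -> : fcons (u j) (omit u j) = [ffun k => u (lift_perm ord0 j 1 k)].
  apply/ffunP => k; rewrite [RHS]ffunE; case: (unliftP ord0 k) => [l ->|->].
    by rewrite fcons_lift ffunE lift_perm_lift perm1.
  by rewrite fcons0 lift_perm_id.
by rewrite alt_perm odd_lift_perm odd_perm1 /= addbF signr_odd.
Qed.

Lemma alt_fcons_crd q (f : alt U V q.+1) x v :
  f (fcons x v) = \sum_i crd i x *: f (fcons (bas i) v).
Proof.
have E y : fcons y v = upd (fcons x v) ord0 y.
  apply/ffunP => k; rewrite [RHS]ffunE; case: (unliftP ord0 k) => [l ->|->].
    by rewrite !fcons_lift eq_sym (negPf (neq_lift _ _)).
  by rewrite eqxx fcons0.
rewrite (alt_upd_crd f _ ord0) fcons0; apply: eq_bigr => i _.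
by rewrite -E.
Qed.

Fact interior_subproof q x (f : alt U V q.+1) :
  (fun v => f (fcons x v)) \in @alt_pred K U V q.
Proof.
apply/asboolP; split=> [u i a y z|u i j ij uij].
  by rewrite !fcons_upd alt_multilinear.
by apply: (@alt_alternating _ _ _ _ f _ (lift ord0 i) (lift ord0 j));
   rewrite ?(inj_eq lift_inj) // !fcons_lift.
Qed.

Definition interior q x (f : alt U V q.+1) : alt U V q :=
  Alt (Phant V) (interior_subproof x f).

(** Allows identities between forms to be proved by induction on the degree. *)
Lemma interior_eq q (f g : alt U V q.+1) :
  (forall x, interior x f = interior x g) -> f = g.
Proof.
move=> fg; apply: Defs.altP => u; rewrite -(fcons_omit0 u).
by have /(congr1 (fun h : alt U V q => h (omit u ord0))) := fg (u ord0).
Qed.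

End Forms.

(** * Contraction against U and its inverse in top degree *)

Section Contraction.
Variables (K : fieldType) (U : vectType K) (V : lmodType K).
Local Notation n := (\dim {:U}).

Definition antisym_fun q (f : alt U V q) (u : {ffun 'I_q.+1 -> U}) : tens V U :=
  \sum_(j < q.+1) (-1) ^+ j *: tensor (f (omit u j)) (u j).

Fact antisym_subproof q (f : alt U V q) :
  antisym_fun f \in @alt_pred K U (tens V U) q.+1.
Proof.
apply/asboolP; split=> [u i a x y|u a b ab uab]; rewrite /antisym_fun.
  rewrite scaler_sumr -big_split /=; apply: eq_bigr => j _.
  rewrite !scalerA commr_sign -!scalerA -scalerDr; congr (_ *: _).
  case: (unliftP j i) => [k ->|->].
    rewrite !omit_upd_lift alt_multilinear tensor_linearl.
    by rewrite !(ffunE _ j) (negPf (neq_lift _ _)).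
  by rewrite !omit_upd !(ffunE _ j) eqxx tensor_linearr.
(* Only the terms omitting a or b can survive. Their argument lists differ by a permutation of sign
   (-1)^(a+b+1), so the two terms cancel; every other term still contains the repeated vector. *)
rewrite (bigD1 a) //= (bigD1 b) 1?eq_sym //= [X in _ + (_ + X)]big1 => [|i].
  rewrite addr0 -uab.
  have [s so ->] := omit_perm ab uab.
  pose tL := GRing.isLinear.Build K V (tens V U) _ _ (@tensor_linearl K U V (u a)).
  pose t : {linear V -> tens V U} := HB.pack (fun x => @tensor K U V x (u a)) tL.
  rewrite alt_perm so -[tensor (_ *: _) _]/(t _) linearZ /= scalerA -scalerDl.
  rewrite -(signr_odd _ a) -(signr_odd _ b) -signr_addb.
  by case: (odd a) (odd b) => [] []; rewrite /= ?expr0 ?expr1 ?subrr ?addNr scale0r.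
move=> /andP[ia ib]; rewrite [f _](_ : _ = 0).
  by apply/ffunP => k; rewrite !ffunE !scaler0.
case: (unliftP i a) ia ab uab => [k -> _|->]; last by rewrite eqxx.
case: (unliftP i b) ib => [l -> _|->]; last by rewrite eqxx.
rewrite (inj_eq lift_inj) => kl ukl.
by apply: (@alt_alternating _ _ _ _ f _ k l kl); rewrite !ffunE.
Qed.

(* V (x) Lambda^q U^* -> V (x) U (x) Lambda^{q+1} U^*, the exterior
   multiplication by the canonical element of U (x) U^*. *)
Definition antisym q (f : alt U V q) : alt U (tens V U) q.+1 :=
  Alt (Phant (tens V U)) (antisym_subproof f).

Lemma antisymE q (f : alt U V q) u :
  antisym f u = \sum_(j < q.+1) (-1) ^+ j *: tensor (f (omit u j)) (u j).
Proof. by []. Qed.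

Lemma contractionE q (X : alt U (tens V U) q.+1) v :
  contraction X v = \sum_i X (fcons (bas i) v) i.
Proof. by []. Qed.

(** In the trace, the term j = 0 contributes f once per basis vector, n times in all. Each of the q
    other terms recombines, by expansion of its argument in the basis, to -f. The total is n - q = 1
    copy of f. *)
Lemma contraction_antisym q (f : alt U V q) :
  n = q.+1 -> contraction (antisym f) = f.
Proof.
move=> nq; apply: Defs.altP => v; rewrite contractionE.
under eq_bigr do rewrite antisymE sum_ffunE big_ord_recl /= omit_fcons0 fcons0
  expr0 scale1r !ffunE crd_bas eqxx scale1r.
rewrite big_split /= sumr_const card_ord exchange_big /= -[X in _ + X]opprK.
rewrite -sumrN [X in _ - X](_ : _ = f v *+ q); last first.
  case: q f v nq => [|q] f v nq; first by rewrite big_ord0.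
  transitivity (\sum_(j < q.+1) f v); last by rewrite sumr_const card_ord.
  apply: eq_bigr => j _; rewrite -sumrN.
  transitivity ((-1) ^+ j *: f (fcons (v j) (omit v j))).
    rewrite alt_fcons_crd scaler_sumr; apply: eq_bigr => i _.
    by rewrite omit_fcons_lift fcons_lift !ffunE exprS mulN1r scaleNr opprK.
  by rewrite alt_fcons_omit scalerA -expr2 sqrr_sign scale1r.
by rewrite nq mulrS addrK.
Qed.

(** Evaluate X on a family of basis vectors. If one repeats, X vanishes by alternation. Otherwise
    all n of them occur; to reach component i, omit [bas i] and contract: every other basis vector
    put in front is a repetition, so the trace reduces to that component up to sign. *)
Lemma contraction_eq0 q (X : alt U (tens V U) q.+1) :
  n = q.+1 -> contraction X = 0 -> X = 0.
Proof.
move=> nq cX; apply: alt_basis_eq0 => g.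
have [gI|] := boolP (injectiveb g); last first.
  move=> /injectivePn[a [b ab gab]].
  by apply: (alt_alternating X ab); rewrite !ffunE gab.
set u := [ffun k => bas (g k)]; apply/ffunP => i; rewrite ffunE.
(* An injection between sets of the same size q + 1 = n is onto. *)
have gS j : exists k, g k = j.
  have /subset_cardP/(_ (subset_predT _))/(_ j) : #|codom g| = #|{: 'I_n}|.
    by rewrite card_codom ?card_ord //; apply/injectiveP.
  by rewrite inE => /codomP[k ->]; exists k.
have [k ki] := gS i.
have := congr1 (fun f : alt U V q => f (omit u k)) cX.
rewrite contractionE (bigD1 i) //= big1 ?addr0 => [|j ji].
  have -> : bas i = u k by rewrite ffunE ki.
  rewrite alt_fcons_omit ffunE => /eqP; rewrite scaler_eq0 signr_eq0 /=.
  by move/eqP.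
have [l lj] := gS j.
have kl : k != l by apply: contraNneq ji => kl; rewrite -lj -kl ki.
case: (unliftP k l) kl lj => [m -> _ lj|->]; last by rewrite eqxx.
rewrite (@alt_alternating _ _ _ _ X _ ord0 (lift ord0 m)) ?neq_lift //.
  by rewrite ffunE.
by rewrite fcons0 fcons_lift !ffunE lj.
Qed.

(** A right inverse of an injective map is also a left inverse. *)
Lemma antisym_contraction q (X : alt U (tens V U) q.+1) :
  n = q.+1 -> antisym (contraction X) = X.
Proof.
move=> nq; apply: (@linear_inj0 _ _ _ (@contraction K U V q)).
  by move=> Y; apply: contraction_eq0.
exact: contraction_antisym.
Qed.

Lemma contraction_bij q :
  n = q.+1 -> bijective (@contraction K U V q).
Proof.
move=> nq; exists (@antisym q) => X; first exact: antisym_contraction.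
exact: contraction_antisym.
Qed.

Lemma contraction_alt_in (S : submodClosed V) q (X : alt U (tens V U) q.+1) :
  n = q.+1 -> (X \in alt_in (tens_in S)) = (contraction X \in alt_in S).
Proof.
move=> nq; apply/asboolP/asboolP => XS u.
  by rewrite contractionE rpred_sum // => i _; have /forallP := XS (fcons (bas i) u).
rewrite -(antisym_contraction X nq) antisymE; apply/forallP => i.
rewrite sum_ffunE rpred_sum // => j _.
by rewrite !ffunE !rpredZ.
Qed.

End Contraction.

(** * Functoriality in the coefficients *)

Section FormsMap.
Variables (K : fieldType) (U : vectType K) (V W : lmodType K).
Variable g : {linear V -> W}.

Lemma contraction_alt_map q (X : alt U (tens V U) q.+1) :
  contraction (alt_map (@tens_map K U V W g) X) = alt_map g (contraction X).
Proof.
apply: Defs.altP => u; rewrite /= linear_sum; apply: eq_bigr => i _.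
by rewrite ffunE.
Qed.

Lemma tens_map_bij : bijective g -> bijective (@tens_map K U V W g).
Proof.
case=> h gK hK; exists (fun t : tens W U => [ffun i => h (t i)]) => t.
  by apply/ffunP => i; rewrite !ffunE gK.
by apply/ffunP => i; rewrite !ffunE hK.
Qed.

Lemma alt_map_bij q : bijective g -> bijective (@alt_map K U V W q g).
Proof.
case=> h gK hK; have hL : linear h.
  by move=> a x y; rewrite -{1}(hK x) -{1}(hK y) -linearP gK.
pose hB := GRing.isLinear.Build K W V _ _ hL.
pose h' : {linear W -> V} := HB.pack h hB.
by exists (alt_map h') => f; apply: Defs.altP => u /=; rewrite ?gK ?hK.
Qed.

End FormsMap.

(** * Coordinate multiplication and Euler's identity on D *)

Section DividedPowers.
Variables (K : fieldType) (U : vectType K).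
Local Notation n := (\dim {:U}).

Lemma gdual_mpolyE (f : gdual U) p :
  f p = \sum_(m <- msupp p) p@_m * f 'X_[m].
Proof.
rewrite {1}(mpolyE p) linear_sum; apply: eq_bigr => m _.
by rewrite linearZ.
Qed.

Lemma gdual_monomial_eq (f g : gdual U) : (forall m, f 'X_[m] = g 'X_[m]) -> f = g.
Proof.
move=> fg; apply: gdualP => p; rewrite !gdual_mpolyE.
by apply: eq_bigr => m _; rewrite fg.
Qed.

Lemma gdual_grP r (f : gdual U) :
  reflect (forall m, mdeg m != r -> f 'X_[m] = 0) (f \in gdual_gr r).
Proof.
apply: (iffP (asboolP _)) => fr => [m mr|s p sr /dhomogP ps].
  by apply: fr mr _; rewrite dhomogX.
rewrite gdual_mpolyE big_seq big1 // => m /ps ms.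
by rewrite fr ?mulr0 // ms.
Qed.

Lemma dhomog_mderiv r i (p : SymAlg K U) :
  p \is r.+1.-homog -> p^`M(i) \is r.-homog.
Proof.
move=> /dhomogP pr; apply/dhomogP => m; rewrite mcoeff_msupp mcoeff_mderiv => pm.
have /pr : (m + U_(i))%MM \in msupp p.
  by rewrite mcoeff_msupp; apply: contraNneq pm => ->; rewrite mul0rn.
by rewrite /= mdegD mdeg1 addn1 => -[].
Qed.

Fact gmul_subproof i (f : gdual U) :
  ((fun p => f p^`M(i)) : SymAlg K U -> K^o) \in @gdual_pred K U.
Proof.
apply/asboolP; split=> [a x y|]; first by rewrite !linearP.
(* The bound grows by one because differentiation lowers the degree by one. *)
have [N fN] := gdual_bound f; exists N.+1 => -[//|r] p Nr /(dhomog_mderiv i).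
exact: fN.
Qed.

(* Transpose of d/dX_i on Sym(U): the product with the i-th coordinate in the
   divided-power algebra D. *)
Definition gmul i (f : gdual U) : gdual U := GDual (gmul_subproof i f).

Fact gmul_is_linear i : linear (gmul i).
Proof. by move=> a f g; apply: gdualP. Qed.
HB.instance Definition _ i :=
  GRing.isLinear.Build K (gdual U) (gdual U) _ (gmul i) (gmul_is_linear i).

Lemma mderiv_symU i (u : U) : (symU u)^`M(i) = (crd i u)%:MP.
Proof.
rewrite linear_sum (bigD1 i) //= big1 ?addr0 => [|j ji].
  by rewrite linearZ /= mderivX mnm1E eqxx scale1r -[X in 'X_[X - _]]add0m addmK mpolyX0 alg_mpolyC.
by rewrite linearZ /= mderivX mnm1E (negPf ji) scale0r scaler0.
Qed.

(** Transpose of the Leibniz rule for d/dX_i applied to u p, with u linear. *)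
Lemma contract_gmul i u f :
  contract (symU u) (gmul i f) = crd i u *: f + gmul i (contract (symU u) f).
Proof.
apply: gdualP => p; rewrite gdual_linearE /= mderivM mderiv_symU linearD /=.
by rewrite mul_mpolyC linearZ.
Qed.

(** Transpose of Euler's identity: the sum of the X_i d/dX_i multiplies X^m by the degree of m. *)
Lemma gdual_euler r f : f \in gdual_gr r ->
  \sum_i gmul i (contract (symU (bas i)) f) = r%:R *: f.
Proof.
move=> /gdual_grP fr; apply: gdual_monomial_eq => m; rewrite gdual_sumE.
rewrite -[r%:R *: f]addr0 gdual_linearE addr0.
have [<-|mr] := eqVneq (mdeg m) r.
  rewrite mdegE natr_sum mulr_suml; apply: eq_bigr => i _ /=.
  rewrite symU_bas mderivX -scalerAr linearZ /= -mpolyXD.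
  (* When m i = 0 the subtraction of U_(i) from m is truncated, but its coefficient m i vanishes. *)
  case: (posnP (m i)) => [->|mi]; first by rewrite scale0r mul0r.
  by rewrite addmC submK // lep1mP -lt0n.
rewrite fr // mulr0 big1 // => i _ /=.
rewrite symU_bas mderivX -scalerAr linearZ /= -mpolyXD.
case: (posnP (m i)) => [->|mi]; first by rewrite scale0r.
by rewrite addmC submK ?lep1mP -?lt0n // fr ?scaler0.
Qed.

Lemma contract_gr r u (f : gdual U) :
  f \in gdual_gr r.+1 -> contract (symU u) f \in gdual_gr r.
Proof.
move=> /gdual_grP fr; apply/gdual_grP => m mr /=.
rewrite /symU mulr_suml linear_sum big1 // => i _ /=.
rewrite -scalerAl linearZ /= -mpolyXD fr ?scaler0 //.
by rewrite mdegD mdeg1 add1n.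
Qed.

Lemma gmul_gr r i (f : gdual U) : f \in gdual_gr r -> gmul i f \in gdual_gr r.+1.
Proof.
move=> /gdual_grP fr; apply/gdual_grP => m mr /=; rewrite mderivX linearZ /=.
case: (posnP (m i)) => [->|mi]; first by rewrite scale0r.
rewrite fr ?scaler0 //; apply: contraNneq mr => <-.
by rewrite -{1}(@submK _ U_(i)%MM m) ?lep1mP -?lt0n // mdegD mdeg1 addn1.
Qed.

(** The Euler vector field, the sum of the x_i d/dx_i, multiplied by f. *)
Definition gmul_tens (f : gdual U) : tens (gdual U) U := [ffun i => gmul i f].

Fact gmul_tens_is_linear : linear gmul_tens.
Proof. by move=> a f g; apply/ffunP => i; rewrite !ffunE linearP. Qed.
HB.instance Definition _ := GRing.isLinear.Build K (gdual U) (tens (gdual U) U) _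
  gmul_tens gmul_tens_is_linear.

End DividedPowers.

(** * Poincaré lemma for the Koszul complex *)

Section Poincare.
Variables (K : fieldType) (U : vectType K).

Lemma koszulE q (f : alt U (gdual U) q) u :
  koszul f u =
    \sum_(j < q.+1) (-1) ^+ j *: contract (symU (u j)) (f (omit u j)).
Proof. by []. Qed.

Lemma interior_koszul0 x (f : alt U (gdual U) 0) :
  interior x (koszul f) = form_act (symU x) f.
Proof.
apply: Defs.altP => v; rewrite /= /koszul_fun big_ord_recl big_ord0 addr0.
by rewrite expr0 scale1r fcons0 omit_fcons0.
Qed.

(* Cartan's formula for the Koszul differential. *)
Lemma interior_koszul q x (f : alt U (gdual U) q.+1) :
  interior x (koszul f) = form_act (symU x) f - koszul (interior x f).
Proof.
apply: Defs.altP => v.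
rewrite -[RHS]/(form_act (symU x) f v - koszul (interior x f) v).
rewrite -[LHS]/(koszul f _) !koszulE big_ord_recl expr0 scale1r fcons0 omit_fcons0.
congr (_ + _); rewrite -sumrN; apply: eq_bigr => j _.
by rewrite omit_fcons_lift fcons_lift exprS mulN1r scaleNr.
Qed.

(** Two uses of Cartan's formula turn the interior product of delta delta f with x into delta delta
    of the interior product of f, the terms x delta f and delta (x f) cancelling; induct on the
    degree. *)
Lemma koszul_koszul q (f : alt U (gdual U) q) : koszul (koszul f) = 0.
Proof.
elim: q f => [|q IH] f; apply: interior_eq => x; rewrite interior_koszul.
  by rewrite interior_koszul0 koszul_act subrr; apply: Defs.altP.
rewrite interior_koszul linearB /= IH subr0 koszul_act subrr.
exact: Defs.altP.
Qed.

(** Interior product with the Euler vector field, the classical Poincaré homotopy before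
    normalization by the degree. *)
Definition homotopy q (f : alt U (gdual U) q.+1) : alt U (gdual U) q :=
  contraction (alt_map (@gmul_tens K U) f).

Lemma homotopyE q (f : alt U (gdual U) q.+1) v :
  homotopy f v = \sum_i gmul i (f (fcons (bas i) v)).
Proof. by apply: eq_bigr => i _; rewrite /= ffunE. Qed.

Lemma koszul_homotopy q r (f : alt U (gdual U) q.+1) : f \in form_gr U q.+1 r ->
  koszul (homotopy f) + homotopy (koszul f) = (r + q.+1)%:R *: f.
Proof.
move=> /asboolP fr; apply: Defs.altP => u.
rewrite -[LHS]/(koszul (homotopy f) u + homotopy (koszul f) u).
rewrite -[RHS]/((r + q.+1)%:R *: f u) natrD addrC scalerDl -(gdual_euler (fr u)).
(* S is the double sum common to both composites. By Cartan's formula and Euler's identity, h delta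
   f is r f - S; commuting contraction past [gmul] gives delta h f = (q+1) f + S. *)
pose S : gdual U := \sum_(j < q.+1) \sum_i
  (-1) ^+ j *: gmul i (contract (symU (u j)) (f (fcons (bas i) (omit u j)))).
have -> : homotopy (koszul f) u
    = \sum_i gmul i (contract (symU (bas i)) (f u)) - S.
  rewrite homotopyE /S exchange_big -sumrB; apply: eq_bigr => i _.
  rewrite -[koszul f _]/(interior (bas i) (koszul f) u) interior_koszul.
  rewrite -[(_ - _ : alt_of _ _ _) _]/(form_act (symU (bas i)) f u - koszul (interior (bas i) f) u).
  rewrite linearB koszulE linear_sum; congr (_ - _).
  by apply: eq_bigr => j _; rewrite linearZ.
rewrite -addrA; congr (_ + _); rewrite koszulE.
transitivity (- S + (\sum_(j < q.+1) f u + S)); last first.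
  by rewrite sumr_const card_ord scaler_nat addrCA addNr addr0.
congr (_ + _); rewrite -big_split; apply: eq_bigr => j _.
rewrite homotopyE linear_sum /=.
under eq_bigr do rewrite contract_gmul.
rewrite big_split /= -alt_fcons_crd alt_fcons_omit scalerDr scalerA -expr2.
by rewrite sqrr_sign scale1r scaler_sumr.
Qed.

Lemma koszul_gr q r (f : alt U (gdual U) q) :
  f \in form_gr U q r.+1 -> koszul f \in form_gr U q.+1 r.
Proof.
move=> /asboolP fr; apply/asboolP => u; rewrite koszulE rpred_sum // => j _.
by rewrite rpredZ // contract_gr.
Qed.

Lemma homotopy_gr q r (f : alt U (gdual U) q.+1) :
  f \in form_gr U q.+1 r -> homotopy f \in form_gr U q r.+1.
Proof.
move=> /asboolP fr; apply/asboolP => u; rewrite homotopyE rpred_sum // => i _.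
exact: gmul_gr.
Qed.

Hypothesis charK : [pchar K] =i pred0.

(** For closed f the homotopy formula leaves delta h f = (r+q+1) f, and the positive integer r+q+1
    is invertible in characteristic zero. *)
Lemma koszul_exact q r (f : alt U (gdual U) q.+1) :
  f \in form_gr U q.+1 r -> koszul f = 0 ->
  exists2 g, g \in form_gr U q r.+1 & f = koszul g.
Proof.
move=> fr f0; exists ((r + q.+1)%:R^-1 *: homotopy f).
  by rewrite rpredZ // homotopy_gr.
rewrite linearZ /=; have := koszul_homotopy fr.
have -> : homotopy (koszul f) = 0.
  rewrite f0; apply: Defs.altP => u; rewrite homotopyE big1 // => i _.
  exact: linear0.
rewrite addr0 => ->; rewrite scalerK // addnS.
by have /pcharf0P -> := charK.
Qed.

Lemma koszul_quotm_iso r :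
  exists phi : {linear quotm (@exact_forms K U 0 r.+1) -> subm (@Z2_gr K U r)},
    bijective phi /\
    forall alpha : subm (form_gr U 1 r.+1),
      subm_val (phi (quotm_pi (@exact_forms K U 0 r.+1) alpha))
        = koszul (subm_val alpha).
Proof.
have kZ (a : subm (form_gr U 1 r.+1)) : koszul (subm_val a) \in @Z2_gr K U r.
  apply/andP; split; last exact/koszul_gr/(valP a).
  by apply/eqP/koszul_koszul.
have kL : linear (fun a => Subm (kZ a)).
  by move=> a x y; apply: val_inj; rewrite /= linearP.
pose kB := GRing.isLinear.Build K _ (subm (@Z2_gr K U r)) _ _ kL.
pose k : {linear subm (form_gr U 1 r.+1) -> subm (@Z2_gr K U r)} :=
  HB.pack (fun a => Subm (kZ a)) kB.
have [] := @quotm_first_iso K _ _ (@exact_forms K U 0 r.+1) k.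
(* The kernel is given by exactness at 1-forms, surjectivity by exactness at 2-forms. *)
- move=> x; rewrite -(inj_eq val_inj) /=; apply/asboolP/eqP => [[g gr ->]|x0].
    exact: koszul_koszul.
  exact: koszul_exact (valP x) x0.
- move=> y; have /andP[/eqP y0 yr] := valP y.
  have [g gr yg] := koszul_exact yr y0.
  by exists (Subm gr); apply: val_inj.
by move=> phi [phiB phiE]; exists phi; split=> // x; rewrite phiE.
Qed.

End Poincare.

(** * The Koszul differential as a divergence *)

Section Divergence.
Variables (K : fieldType) (U : vectType K).

Lemma koszul_antisym q (f : alt U (gdual U) q) :
  koszul f = alt_map (@divU K U) (antisym f).
Proof.
apply: Defs.altP => u; rewrite koszulE [RHS]/= [antisym_fun _ _]/antisym_fun linear_sum.
by apply: eq_bigr => j _; rewrite linearZ -divU_tensor.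
Qed.

Lemma koszul_contraction q (X : alt U (tens (gdual U) U) q.+1) :
  \dim {:U} = q.+1 -> koszul (contraction X) = alt_map (@divU K U) X.
Proof. by move=> dimU; rewrite koszul_antisym antisym_contraction. Qed.

Lemma ker_div3_contraction (X : alt U (tens (gdual U) U) 3) :
  \dim {:U} = 3%N -> (X \in @ker_div3 K U) = (contraction X \in @Z2 K U).
Proof.
move=> dimU; rewrite -[RHS]/(koszul (contraction X) == 0).
by rewrite koszul_contraction.
Qed.

Lemma contraction_vf_act p (X : alt U (tens (gdual U) U) 3) :
  contraction (vf_act p X) = form_act p (contraction X).
Proof. exact: contraction_alt_map. Qed.

End Divergence.

(** * Divided powers as polynomial functions *)

Section Polynomials.
Variables (K : fieldType) (U : vectType K).
Hypothesis charK : [pchar K] =i pred0.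

Lemma mfact_neq0 (m : 'X_{1.. \dim {:U}}) : (mfact m)%:R != 0 :> K.
Proof.
have /pcharf0P -> := charK.
by rewrite -lt0n prodn_gt0 // => i; apply: fact_gt0.
Qed.

Lemma gdual_pol_inj : injective (@gdual_pol K U).
Proof.
move=> f g fg; apply: gdual_monomial_eq => m.
have := congr1 (mcoeff m) fg; rewrite !mcoeff_gdual_pol => /divIf; apply.
exact: mfact_neq0.
Qed.

Fact pol_gdual_subproof (g : Pol K U) :
  ((fun p => \sum_(m <- msupp g) p@_m * (g@_m * (mfact m)%:R)) : SymAlg K U -> K^o)
    \in @gdual_pred K U.
Proof.
apply/asboolP; split=> [a x y|].
  rewrite scaler_sumr -big_split /=; apply: eq_bigr => m _.
  by rewrite mcoeffD mcoeffZ mulrDl -mulrA.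
(* Every monomial of g has degree below [msize g], so none occurs in a homogeneous p of degree at
   least that. *)
exists (msize g) => r p gr /dhomogP pr; rewrite big_seq big1 // => m gm.
rewrite memN_msupp_eq0 ?mul0r //; apply/negP => /pr mr.
by have := msize_mdeg_lt gm; rewrite -[mdeg m]/(mdeg m) mr ltnNge gr.
Qed.

Lemma gdual_pol_bij : bijective (@gdual_pol K U).
Proof.
apply: inj_surj_bij => [|g]; first exact: gdual_pol_inj.
(* The preimage of g sends X^m to m! times the coefficient of x^m in g. *)
exists (GDual (pol_gdual_subproof g)); apply/mpolyP => m.
rewrite mcoeff_gdual_pol /=.
under eq_bigr do rewrite mcoeffX.
have [gm|gm] := boolP (m \in msupp g).
  rewrite (bigD1_seq m) ?msupp_uniq //= eqxx mul1r big1 ?addr0 => [|k km].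
    by rewrite mulfK // mfact_neq0.
  by rewrite eq_sym (negPf km) mul0r.
rewrite (memN_msupp_eq0 gm) big_seq big1 ?mul0r // => k kg.
by case: eqP kg gm => [->->|_ _ _]; rewrite ?mul0r.
Qed.

Lemma mfactD (m k : 'X_{1.. \dim {:U}}) :
  mfact (m + k) = ((\prod_i ((m + k)%MM i) ^_ (m i)) * mfact k)%N.
Proof.
rewrite /mfact -big_split; apply: eq_bigr => i _ /=.
by rewrite mnmDE -{3}(addKn (m i) (k i)) ffact_fact ?leq_addr.
Qed.

(** Compare coefficients of x^k for p = X^m: differentiating x^(m+k) produces (m+k)!/k!, which turns
    the divisor (m+k)! into the divisor k! of the contracted functional. *)
Lemma gdual_pol_contract p (f : gdual U) :
  gdual_pol (contract p f) = pol_diff p (gdual_pol f).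
Proof.
apply/mpolyP => k; rewrite mcoeff_gdual_pol /= /pol_diff raddf_sum /=.
rewrite {1}(mpolyE p) mulr_suml linear_sum mulr_suml; apply: eq_bigr => m _.
rewrite -scalerAl linearZ /= -mpolyXD mcoeffZ mcoeff_mderivm mcoeff_gdual_pol.
rewrite -mulrA; congr (_ * _); rewrite -[RHS]mulr_natr mfactD natrM -[RHS]mulrA; congr (_ * _).
have := mfact_neq0 (m + k); rewrite mfactD natrM mulf_eq0 negb_or => /andP[c0 _].
by rewrite invfM mulrAC mulVf ?mul1r.
Qed.

Lemma gdual_pol_gr r (f : gdual U) :
  (f \in gdual_gr r) = (gdual_pol f \is r.-homog).
Proof.
apply/gdual_grP/dhomogP => fr m.
  rewrite mcoeff_msupp mcoeff_gdual_pol; apply: contraNeq => mr.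
  by rewrite fr // mul0r.
apply: contraNeq => f0; apply/eqP/fr; rewrite mcoeff_msupp mcoeff_gdual_pol.
by rewrite mulf_neq0 // invr_eq0 mfact_neq0.
Qed.

Lemma pol_diffX i (g : Pol K U) : pol_diff 'X_i g = g^`M(i).
Proof. by rewrite /pol_diff msuppX big_seq1 mcoeffX eqxx scale1r mderivmU1m. Qed.

Lemma pol_divU_gdual_pol (t : tens (gdual U) U) :
  pol_divU (@tens_map K U _ _ (@gdual_pol K U) t) = gdual_pol (divU t).
Proof.
rewrite /divU linear_sum; apply: eq_bigr => i _.
by rewrite ffunE /= gdual_pol_contract symU_bas pol_diffX.
Qed.

Lemma vf_pol_bij : bijective (@vf_pol K U).
Proof. exact/alt_map_bij/tens_map_bij/gdual_pol_bij. Qed.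

Lemma ker_div3_vf_pol (X : alt U (tens (gdual U) U) 3) :
  (X \in @ker_div3 K U) = (vf_pol X \in @ker_pol_div3 K U).
Proof.
rewrite -[LHS]/(div3 X == 0) -[RHS]/(pol_div3 (vf_pol X) == 0).
(* The identification with polynomials intertwines the two divergences and is injective on forms, so
   the kernels correspond. *)
have -> : pol_div3 (vf_pol X) = alt_map (@gdual_pol K U) (div3 X).
  by apply: Defs.altP => u; apply: pol_divU_gdual_pol.
have /bij_inj gI := alt_map_bij U 3 gdual_pol_bij.
by rewrite -[in RHS](linear0 (@alt_map K U _ _ 3 (@gdual_pol K U))) (inj_eq gI).
Qed.

Lemma vf_pol_act p (X : alt U (tens (gdual U) U) 3) :
  vf_pol (vf_act p X) = pol_vf_act p (vf_pol X).
Proof.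
apply: Defs.altP => u; apply/ffunP => i; rewrite /= !ffunE.
exact: gdual_pol_contract.
Qed.

Lemma vf_pol_gr r (X : alt U (tens (gdual U) U) 3) :
  (X \in vf_gr r) = (vf_pol X \in pol_vf_gr r).
Proof.
apply/asboolP/asboolP => Xr u; apply/forallP => i; have /forallP/(_ i) := Xr u;
  by rewrite ?ffunE gdual_pol_gr.
Qed.

End Polynomials.

(** * Closed two-forms and, in rank three, divergence-free fields *)

Unset Implicit Arguments.
Set Strict Implicit.
Set Printing Implicit Defensive.

Theorem proposition5p1 (K : fieldType) (charK : [pchar K] =i pred0)
    (U : vectType K) :
  (forall r : nat,
     exists phi : {linear quotm (@exact_forms K U 0 r.+1) -> subm (@Z2_gr K U r)},
       bijective phi /\
       forall alpha : subm (form_gr U 1 r.+1),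
         subm_val (phi (quotm_pi (@exact_forms K U 0 r.+1) alpha))
           = koszul (subm_val alpha)) /\
  (\dim {:U} = 3%N ->
   [/\ (* U (x) Lambda^3 U^* ~ Lambda^2 U^*, and the same tensored with D *)
       bijective (@contraction _ _ _ _ : alt U (tens K^o U) 3 -> alt U K^o 2) /\
       bijective (@contraction _ _ _ _ : alt U (tens (gdual U) U) 3 -> alt U (gdual U) 2),
       (* ker div ~ Z^2(U), as graded R-modules *)
       [/\ exists psi : {linear subm (@ker_div3 K U) -> subm (@Z2 K U)},
             bijective psi /\
             forall X, subm_val (psi X) = contraction (subm_val X),
           forall (p : SymAlg K U) (X : alt U (tens (gdual U) U) 3),
             contraction (vf_act p X) = form_act p (contraction X)
         & forall r (X : alt U (tens (gdual U) U) 3),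
             (X \in vf_gr r) = (contraction X \in form_gr U 2 r)],
       (* D ~ polynomial functions on U, contraction ~ differentiation *)
       [/\ bijective (@gdual_pol K U),
           forall (p : SymAlg K U) (f : gdual U),
             gdual_pol (contract p f) = pol_diff p (gdual_pol f)
         & forall r (f : gdual U), (f \in gdual_gr r) = (gdual_pol f \is r.-homog)],
       (* D (x) U (x) Lambda^3 U^* ~ twisted polynomial vector fields *)
       [/\ bijective (@vf_pol K U),
           forall (X : alt U (tens (gdual U) U) 3),
             (X \in @ker_div3 K U) = (vf_pol X \in @ker_pol_div3 K U),
           forall (p : SymAlg K U) (X : alt U (tens (gdual U) U) 3),
             vf_pol (vf_act p X) = pol_vf_act p (vf_pol X)
         & forall r (X : alt U (tens (gdual U) U) 3),
             (X \in vf_gr r) = (vf_pol X \in pol_vf_gr r)]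
     & (* rank-three inverse systems *)
       forall N : set (alt U (gdual U) 2),
         (inverse_system N <-> divfree_system [set X | N (contraction X)]) /\
         (inverse_system N <->
            divfree_pol_system (@vf_pol K U @` [set X | N (contraction X)]))]).
Proof.
split=> [r|dimU]; first exact: koszul_quotm_iso.
have cB := @contraction_bij K U (gdual U) 2 dimU.
have cker X := @ker_div3_contraction K U X dimU.
have cgr r (X : alt U (tens (gdual U) U) 3) :
    (X \in vf_gr r) = (contraction X \in form_gr U 2 r).
  exact: contraction_alt_in.
have vB := @vf_pol_bij K U charK.
have vker := @ker_div3_vf_pol K U charK.
have vact := @vf_pol_act K U charK.
have vgr := @vf_pol_gr K U charK.
have sys N := @fd_graded_submodule_preim _ _ _ _ _ _ _ _ _ _ _ cB
  (@contraction_vf_act K U) cgr cker N.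
split=> //.
- by split=> //; apply: contraction_bij.
- split=> //; first exact: subm_bij.
  exact: contraction_vf_act.
- by split; [exact: gdual_pol_bij | exact: gdual_pol_contract | exact: gdual_pol_gr].
move=> N; split; first exact: sys.
(* The transport lemma concerns preimages; by injectivity of [vf_pol], the preimage of the image is
   the original set. *)
have setE : [set X | (@vf_pol K U @` [set X | N (contraction X)]) (vf_pol X)]
    = [set X | N (contraction X)].
  apply/seteqP; split=> X /=; last by exists X.
  by move=> [Y NY /(bij_inj vB) <-].
apply: (iff_trans (sys N)); apply: iff_sym; rewrite -{2}setE.
exact: fd_graded_submodule_preim vB vact vgr vker _.
Qed.
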